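(* Let $G$ be a finite group. Then $$\lim_{n\to\infty}\alpha(G^n)=\frac{1}{\varphi(\exp(G))}.$$
   Context: For a finite group $H$, $c(H)$ denotes the number of cyclic subgroups of $H$ (including the trivial one) and $\alpha(H):=c(H)/|H|$. $G^n=G\times\cdots\times G$ ($n$ factors), $\varphi$ is Euler's totient function, and $\exp(G)$ is the exponent of $G$, i.e. the least common multiple of the orders of the elements of $G$. *)

(* Defs.v *)
From mathcomp Require Import all_boot all_order all_algebra.
From mathcomp Require Import all_fingroup all_solvable.
From mathcomp Require Import all_classical all_reals all_analysis.
Import numFieldNormedType.Exports.

Set Implicit Arguments.
Unset Strict Implicit.
Unset Printing Implicit Defensive.

Import GroupScope GRing.Theory Num.Theory.
Local Open Scope ring_scope.

Definition num_cyclic (gT : finGroupType) (H : {group gT}) : nat :=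
  #|[set K in subgroups H | cyclic K]|.

Definition cyclic_ratio (R : realType) (gT : finGroupType) (H : {group gT}) : R :=
  (num_cyclic H)%:R / #|H|%:R.
Arguments cyclic_ratio R {gT} H.

(* [n = 0] gives the trivial group, the empty product. *)
Definition power_group (gT : finGroupType) (G : {group gT}) (n : nat) :=
  [group of setXn (fun _ : 'I_n => G)].

(* Main.v *)
Require Import Defs.
From mathcomp Require Import all_boot all_order all_algebra.
From mathcomp Require Import all_fingroup all_solvable.
From mathcomp Require Import all_classical all_reals all_analysis.
From mathcomp Require Import lra.
Import numFieldNormedType.Exports.
Import Order.TTheory GRing.Theory Num.Theory.
Local Open Scope ring_scope.

(** A cyclic subgroup of order [d] has [totient d] generators, so weighting each
element [x] by the inverse of [totient #[x]] gives every cyclic subgroup total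
weight 1 ([num_cyclicE]).  Hence the ratio of a group [H] is the average over
[H] of these weights, which lie in the interval from 0 to 1.

In a power of [G] almost every element has order [e := exponent G], and so
weight the inverse of [totient e].  Indeed an element of smaller order [d] has
all its coordinates among the [g] in [G] with [g ^+ d = 1]; as [d < e], these
form a proper subset of [G].  So at most [e * (#|G| - 1) ^ n] elements of the
[n]-th power have order different from [e] ([card_order_neq_exponent]), a
proportion which decays geometrically.  Since two weights differ by at most 1,
this proportion bounds the distance from the ratio to its limit. *)

Lemma card_cyclic_generators (gT : finGroupType) (K : {group gT}) :
  cyclic K -> #|[set x | <[x]>%G == K]| = totient #|K|.
Proof.
case/cyclicP=> a Ka.
rewrite Ka -orderE totient_gen; apply: eq_card => x.
rewrite !inE; apply/eqP/eqP=> defK; last exact/group_inj/esym/(etrans Ka).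
by rewrite -Ka -defK.
Qed.

(** Grouping the elements of [H] by the subgroup that they generate. *)
Lemma num_cyclicE (R : realType) (gT : finGroupType) (H : {group gT}) :
  (num_cyclic H)%:R = \sum_(x in H) (totient #[x]%g)%:R^-1 :> R.
Proof.
pose C := [set K in subgroups H | cyclic K].
rewrite /num_cyclic -/C (partition_big (fun x => <[x]>%G) (mem C)) /=; last first.
  by move=> x Hx; rewrite !inE cycle_subG Hx cycle_cyclic.
rewrite -sum1_card natr_sum; apply: eq_bigr => K.
rewrite !inE => /andP[sKH cycK].
rewrite (eq_bigl [in [set x | <[x]>%G == K]]); last first.
  move=> x; rewrite !inE andb_idl // => /eqP defK.
  by rewrite -cycle_subG -defK in sKH *.
rewrite (eq_bigr (fun=> (totient #|K|)%:R^-1)); last first.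
  by move=> x; rewrite inE orderE => /eqP <-.
rewrite sumr_const card_cyclic_generators // -[RHS]mulr_natr mulVf //.
by rewrite pnatr_eq0 -lt0n totient_gt0 cardG_gt0.
Qed.

Lemma dffunX (I : finType) (gT : I -> finGroupType)
    (x : {dffun forall i, gT i}) (d : nat) (i : I) :
  (x ^+ d)%g i = (x i ^+ d)%g.
Proof. by elim: d => [|d IHd]; rewrite ?ffunE // !expgS ffunE IHd. Qed.

Lemma card_power_group (gT : finGroupType) (G : {group gT}) (n : nat) :
  #|power_group G n| = (#|G| ^ n)%N.
Proof. by rewrite /= cardsXn prod_nat_const card_ord. Qed.

(** If all [g] in [G] had [g ^+ d = 1], the exponent would divide [d], which is
positive and smaller. *)
Lemma card_torsion_lt (gT : finGroupType) (G : {group gT}) (d : nat) :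
  (0 < d < exponent G)%N -> (#|[set g in G | (g ^+ d == 1)%g]| < #|G|)%N.
Proof.
case/andP=> d_gt0 lt_de; apply/proper_card/properP; split.
  by apply/fintype.subsetP=> g; rewrite inE => /andP[].
have [g Gg gd] : exists2 g, g \in G & (g ^+ d != 1)%g.
  apply/exists_inP; apply: contraLR lt_de; rewrite negb_exists_in -leqNgt.
  move=> /forall_inP G1; apply: dvdn_leq => //; apply/exponentP=> g Gg.
  by apply/eqP; rewrite -[_ == _]negbK G1.
by exists g; rewrite ?inE ?Gg.
Qed.

(** A union bound over the possible orders [d < exponent G]: an element [x] of
order [d] has all its coordinates in the [d]-torsion of [G], which misses at
least one element of [G]. *)
Lemma card_order_neq_exponent (gT : finGroupType) (G : {group gT}) (n : nat) :
  (#|[set x in power_group G n | #[x]%g != exponent G]|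
     <= exponent G * #|G|.-1 ^ n)%N.
Proof.
set B := [set x in _ | _]; set e := exponent G.
pose T d := [set g in G | (g ^+ d == 1)%g].
have sBT : B \subset
    \bigcup_(d < e | (0 < d)%N) setXn (fun _ : 'I_n => T d).
  apply/fintype.subsetP=> x; rewrite inE => /andP[/setXnP Gx ne_xe].
  have dv_xe : (#[x]%g %| e)%N.
    rewrite order_dvdn; apply/eqP/ffunP=> i.
    by rewrite dffunX expg_exponent // ffunE.
  have lt_xe : (#[x]%g < e)%N.
    by rewrite ltn_neqAle ne_xe dvdn_leq // exponent_gt0.
  apply/bigcupP; exists (Ordinal lt_xe); first exact: order_gt0.
  apply/setXnP=> i; rewrite inE Gx /=.
  by rewrite -dffunX expg_order ffunE.
apply: leq_trans (subset_leq_card sBT) _.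
apply: (@leq_trans
  (\sum_(d < e | (0 < d)%N) #|setXn (fun _ : 'I_n => T d)|)%N).
  elim/big_rec2: _ => [|d A m _ leAm]; first by rewrite cards0.
  by rewrite (leq_trans (leq_card_setU _ _)) // leq_add2l.
rewrite -[X in (_ <= X * _)%N]card_ord -sum_nat_const big_mkcond /=.
apply: leq_sum => d _; case: ifP => // d_gt0.
rewrite cardsXn prod_nat_const card_ord.
have /card_torsion_lt : (0 < d < exponent G)%N by rewrite d_gt0 /=.
(* [leq_exp2r] needs a nonzero exponent; for [n = 0] both powers are 1. *)
move=> lt_TG; case: n {B sBT} => // n; rewrite leq_exp2r //.
by rewrite -ltnS prednK ?cardG_gt0.
Qed.

(** The difference is the average over the elements [x] of the power of
[(totient #[x])^-1 - (totient (exponent G))^-1], which vanishes when [x] has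
order [exponent G] and is otherwise at most 1 in absolute value. *)
Lemma cyclic_ratio_power_dist (R : realType) (gT : finGroupType)
    (G : {group gT}) (n : nat) :
  `|cyclic_ratio R (power_group G n) - (totient (exponent G))%:R^-1|
     <= (exponent G)%:R * (#|G|.-1%:R / #|G|%:R) ^+ n.
Proof.
set P := power_group G n; set w := (totient (exponent G))%:R^-1.
have P_gt0 : 0 < #|P|%:R :> R by rewrite ltr0n cardG_gt0.
have w01 d : 0 <= ((totient d)%:R^-1 : R) <= 1.
  rewrite invr_ge0 ler0n /=; case: (posnP (totient d)) => [->|td].
    by rewrite invr0 ler01.
  by rewrite invf_le1 ?ltr0n // ler1n.
have -> : cyclic_ratio R P - w =
    (\sum_(x in P) ((totient #[x]%g)%:R^-1 - w)) / #|P|%:R.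
  rewrite sumrB sumr_const -num_cyclicE mulrBl -[w *+ _]mulr_natr mulfK //.
  by rewrite lt0r_neq0.
rewrite normrM normfV (gtr0_norm P_gt0) ler_pdivrMr //.
have -> : (exponent G)%:R * (#|G|.-1%:R / #|G|%:R) ^+ n * #|P|%:R
    = (exponent G * #|G|.-1 ^ n)%:R :> R.
  rewrite card_power_group natrM !natrX expr_div_n -mulrA divfK //.
  by rewrite expf_neq0 // pnatr_eq0 -lt0n cardG_gt0.
apply: le_trans (ler_norm_sum _ _ _) _.
pose B := [set x in P | #[x]%g != exponent G].
have inB x : (x \in B) = (x \in P) && (#[x]%g != exponent G) by rewrite inE.
apply: le_trans (_ : #|B|%:R <= _); last first.
  by rewrite ler_nat card_order_neq_exponent.
rewrite -sum1_card natr_sum big_mkcond [leRHS]big_mkcond.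
apply: ler_sum => x _; rewrite inB; case: (x \in P) => //.
case: (eqVneq #[x]%g (exponent G)) => [->|_]; first by rewrite subrr normr0.
have /andP[w_ge0 w_le1] : 0 <= w <= 1 := w01 _.
have /andP[wx_ge0 wx_le1] := w01 #[x]%g.
by rewrite /= ler_norml; lra.
Qed.

Local Open Scope classical_set_scope.
Local Open Scope ring_scope.

Theorem theorem3 (R : realType) (gT : finGroupType) (G : {group gT}) :
  (fun n : nat => cyclic_ratio R (power_group G n)) @ \oo
    --> ((totient (exponent G))%:R^-1 : R).
Proof.
set w : R := _^-1; pose q : R := #|G|.-1%:R / #|G|%:R.
have q_lt1 : `|q| < 1.
  rewrite ger0_norm ?divr_ge0 ?ler0n //.
  by rewrite ltr_pdivrMr ?ltr0n ?cardG_gt0 // mul1r ltr_nat ltn_predL cardG_gt0.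
have dist0 : (fun n => (exponent G)%:R * q ^+ n) @ \oo --> (0 : R).
  rewrite -[X in _ --> X](mulr0 (exponent G)%:R).
  exact: cvgMl_tmp (cvg_expr q_lt1).
apply/cvgrPdist_le => eps eps_gt0.
have /cvgrPdist_le /(_ eps eps_gt0) := dist0.
apply: filterS => n; rewrite sub0r normrN => le_eps.
rewrite distrC; apply: le_trans (cyclic_ratio_power_dist R gT G n) _.
exact: le_trans (ler_norm _) le_eps.
Qed.
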